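(* Put, for all $\alpha_1, \alpha_2 \in (0,1)$, $\delta > 0$ and $K : (0,\infty) \to (0, \infty)$, $$B(\alpha_2,K,\delta):=\sqrt{\left(K\left(\tfrac\delta4\right)+\tfrac\delta8\right)^2 + 2\,\Theta\left(\alpha_2^{-1}-1,\ K\left(\tfrac\delta4\right)+\tfrac\delta8,\ K\left(\tfrac\delta4\right)+\tfrac\delta8,\ \tfrac\delta8\right)},$$ $$\Phi(\alpha_1,\alpha_2,K,\delta):=B(\alpha_2,K,\delta) \cdot \max\left(\sqrt{2}, \frac{4B(\alpha_2,K,\delta)}\delta \right) \cdot \frac1{1-\alpha_1} + \frac{\alpha_1}{1-\alpha_1} \left(K\left(\tfrac\delta4\right)+\tfrac\delta8\right) + \frac\delta8,$$ where $\Theta$ is the explicit function given in the context. Let $X$ be a Hilbert space. Let $\alpha_1, \alpha_2 \in (0,1)$ and $R_1, R_2:X \to X$ be such that for each $i \in \{1,2\}$, $R_i$ is $\alpha_i$-averaged. Put $R:=R_2 \circ R_1$. Let $K: (0,\infty) \to (0,\infty)$ be such that for all $i \in \{1,2\}$ and all $\varepsilon > 0$ there is a $p \in X$ with $\|p\| \leq K(\varepsilon)$ and $\|p-R_ip\| \leq \varepsilon$. Then for all $\delta > 0$ there is a $p \in X$ with $\|p\| \leq \Phi(\alpha_1,\alpha_2,K,\delta)$ and $\|p-Rp\| \leq \delta$.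
   Context: Averaged mappings. Let $X$ be a Hilbert space. A mapping $T: X \to X$ is nonexpansive if $\|Tx-Ty\| \leq \|x-y\|$ for all $x,y \in X$. For $\alpha \in (0,1)$, a mapping $R:X \to X$ is $\alpha$-averaged if there is a nonexpansive $T:X \to X$ such that $Rx = (1-\alpha)x+\alpha Tx$ for all $x \in X$. The function $\Theta$. For $\beta, L_1, L_2, L_3 > 0$, $$\Theta(\beta,L_1,L_2,L_3):=(L_1+L_2) \left(L_3 + \frac{L_1+L_2+2\beta L_3 + \sqrt{L_1^2 + L_2^2 + 2L_1L_2 + 8\beta L_1L_3 + 4\beta L_2L_3}}{2\beta}\right).$$ *)

(* Defs.v *)
From HB Require Import structures.
From mathcomp Require Import all_boot all_order all_algebra.
From mathcomp Require Import reals topology normedtype.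

Set Implicit Arguments.
Unset Strict Implicit.
Unset Printing Implicit Defensive.

Import Order.TTheory GRing.Theory Num.Theory.
Import numFieldNormedType.Exports.

Local Open Scope ring_scope.

Definition nonexpansive (R : realType) (X : normedModType R) (T : X -> X) : Prop :=
  forall x y : X, `|T x - T y| <= `|x - y|.

(* Meaningful for 0 < alpha < 1; the range of alpha is not part of the
   predicate and is assumed separately. *)
Definition averaged (R : realType) (X : normedModType R) (alpha : R)
    (S : X -> X) : Prop :=
  exists T : X -> X, nonexpansive T /\
    forall x : X, S x = (1 - alpha) *: x + alpha *: T x.

Definition Theta (R : realType) (beta L1 L2 L3 : R) : R :=
  (L1 + L2) *
  (L3 + (L1 + L2 + 2 * beta * L3
         + Num.sqrt (L1 ^+ 2 + L2 ^+ 2 + 2 * L1 * L2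
                     + 8 * beta * L1 * L3 + 4 * beta * L2 * L3))
        / (2 * beta)).

Definition B (R : realType) (alpha2 : R) (K : R -> R) (delta : R) : R :=
  Num.sqrt ((K (delta / 4) + delta / 8) ^+ 2
            + 2 * Theta (alpha2^-1 - 1) (K (delta / 4) + delta / 8)
                        (K (delta / 4) + delta / 8) (delta / 8)).

Definition Phi (R : realType) (alpha1 alpha2 : R) (K : R -> R) (delta : R) : R :=
  B alpha2 K delta * Num.max (Num.sqrt 2) (4 * B alpha2 K delta / delta)
    * (1 / (1 - alpha1))
  + alpha1 / (1 - alpha1) * (K (delta / 4) + delta / 8)
  + delta / 8.

(* Main.v *)
Require Import Defs.
From HB Require Import structures.
From mathcomp Require Import all_boot all_order all_algebra.
From mathcomp Require Import reals topology normedtype.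
From mathcomp Require Import classical_sets functions boolp interval_inference.
From mathcomp Require Import sequences.
From mathcomp Require Import ring lra.

Set Implicit Arguments.
Unset Strict Implicit.
Unset Printing Implicit Defensive.

Import Order.TTheory GRing.Theory Num.Theory.
Import numFieldNormedType.Exports.

Local Open Scope ring_scope.

(* Each [Ri] is the reflected resolvent of a cocoercive operator [Ai], that is
   [Ri (x + Ai x) = x - Ai x], and approximate fixed points of [Ri] correspond
   to approximate zeros [ai] of [Ai].  With [p = x + A1 x], nonexpansiveness of
   [R2] gives [`|p - R2 (R1 p)| <= 2 * `|A1 x + A2 x|], so it suffices to find
   an approximate zero [x] of [A1 + A2].  Take the solution of
   [eps *: x + A1 x + A2 x = A1 a1 + A2 a2], which exists because the left-hand
   side is strongly monotone and Lipschitz; the Brezis-Haraux argument bounds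
   [eps * `|x| ^+ 2] independently of [eps], so that [eps *: x] is small. *)

(** * Fixed points of contractions *)

Lemma contraction_has_fixed_point (R : realType) (X : completeNormedModType R)
    (f : X -> X) (q : R) (q_ge0 : 0 <= q) (q_lt1 : q < 1)
    (f_lip : forall x y, `|f x - f y| <= q * `|x - y|) :
  exists x, f x = x.
Proof.
have f_fun : set_fun setT setT f by [].
pose g : {fun [set: X] >-> [set: X]} := mkfun f_fun.
have g_contr : is_contraction g.
  by exists (NngNum q_ge0); split => //= -[x y] _; exact: f_lip.
have [] := @banach_fixed_point R X setT g g_contr; [exact: closedT|by exists 0|].
move=> x _ xE.
by exists x; rewrite [RHS]xE.
Qed.

(** * Inner product calculus *)

Section InnerProduct.
Context {R : realType} {X : completeNormedModType R}.
Variables (dot : {dot X for idfun}) (dotE : forall x : X, dot x x = `|x| ^+ 2).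
Implicit Types (x y u v : X) (A C F S : X -> X).

Lemma dotC u v : dot u v = dot v u.
Proof. by rewrite (hermC dot) expr0 mul1r. Qed.

Lemma dotDl u v x : dot (u + v) x = dot u x + dot v x.
Proof. exact: linearDl. Qed.

Lemma dotNl u x : dot (- u) x = - dot u x.
Proof. exact: linearNl. Qed.

Lemma dotZl k u x : dot (k *: u) x = k * dot u x.
Proof. exact: linearZl_LR. Qed.

Lemma dotDr u v x : dot x (u + v) = dot x u + dot x v.
Proof. by rewrite !(dotC x) dotDl. Qed.

Lemma dotNr u x : dot x (- u) = - dot x u.
Proof. by rewrite !(dotC x) dotNl. Qed.

Lemma dotZr k u x : dot x (k *: u) = k * dot x u.
Proof. by rewrite !(dotC x) dotZl. Qed.

Definition dot_linear := (dotDl, dotDr, dotNl, dotNr, dotZl, dotZr).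

(** Pairing with an arbitrary [w] turns vector identities into scalar ones, within reach of [ring],
    [field] and [lra] after [dot_linear]. *)
Lemma dot_inj u v : (forall w, dot u w = dot v w) -> u = v.
Proof.
move=> uv; apply/eqP; rewrite -subr_eq0 -normr_eq0 -sqrf_eq0 -dotE.
by rewrite dotDl dotNl uv subrr.
Qed.

Lemma dot_ge0 x : 0 <= dot x x.
Proof. by rewrite dotE exprn_ge0. Qed.

Lemma dot_ler_norm x y k : 0 <= k -> dot x x <= k ^+ 2 * dot y y ->
  `|x| <= k * `|y|.
Proof.
by move=> k0; rewrite !dotE -exprMn ler_pXn2r// nnegrE// mulr_ge0.
Qed.

Lemma norm_ler_dot x y k : `|x| <= k * `|y| -> dot x x <= k ^+ 2 * dot y y.
Proof.
move=> xy; rewrite !dotE -exprMn ler_pXn2r// nnegrE//.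
exact: le_trans xy.
Qed.

(** * Strongly monotone Lipschitz equations *)

Lemma strongly_monotone_surjective F (m L : R) (m_gt0 : 0 < m) (L_ge0 : 0 <= L)
    (F_mono : forall x y, m * dot (x - y) (x - y) <= dot (F x - F y) (x - y))
    (F_lip : forall x y, `|F x - F y| <= L * `|x - y|) (s : X) :
  exists x, F x = s.
Proof.
have N0 : 0 < L + m by lra.
(* The map [x - t *: (F x - s)] multiplies squared distances by at most
   [1 - 2 * t * m + t ^+ 2 * (L + m) ^+ 2], which is [q2]. Taking [L + m] instead of [L] keeps the
   denominator positive and [q2] nonnegative. *)
pose t := m / (L + m) ^+ 2.
have t0 : 0 < t by rewrite divr_gt0// exprn_gt0.
pose q2 := 1 - (m / (L + m)) ^+ 2.
have mN : m / (L + m) <= 1 by rewrite ler_pdivrMr//; lra.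
have mN0 : 0 < m / (L + m) by rewrite divr_gt0.
have q20 : 0 <= q2 by rewrite /q2; nra.
have q21 : q2 < 1 by rewrite /q2; nra.
have [|||x] := @contraction_has_fixed_point R X
  (fun x => x - t *: (F x - s)) (Num.sqrt q2).
- exact: sqrtr_ge0.
- by rewrite -[ltRHS]sqrtr1 ltr_sqrt.
- move=> x y; apply: dot_ler_norm; first exact: sqrtr_ge0.
  rewrite sqr_sqrtr//.
  have -> : x - t *: (F x - s) - (y - t *: (F y - s))
     = (x - y) - t *: (F x - F y).
    by apply: dot_inj => w; rewrite !dot_linear; ring.
  have := F_mono x y; have := norm_ler_dot (F_lip x y).
  move: (dot_ge0 (x - y)).
  move: (x - y) (F x - F y) => d e d0 lip mono.
  rewrite !dot_linear (dotC d e).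
  have N2 : 0 < (L + m) ^+ 2 by rewrite exprn_gt0.
  have : dot e e <= (L + m) ^+ 2 * dot d d.
    by apply: le_trans lip _; apply: ler_wpM2r => //; nra.
  have tN : t * (L + m) ^+ 2 = m by rewrite /t divfK// gt_eqF.
  have q2E : q2 = 1 - t * m by rewrite /q2 /t; field; rewrite gt_eqF.
  rewrite q2E => eL.
  have : t * (t * dot e e) <= t * (m * dot d d).
    apply: ler_wpM2l; first exact: ltW.
    by rewrite -tN -mulrA; apply: ler_wpM2l => //; exact: ltW.
  have : t * (m * dot d d) <= t * dot e d by apply: ler_wpM2l => //; exact: ltW.
  lra.
move/eqP; rewrite -subr_eq0 addrAC subrr sub0r oppr_eq0 scaler_eq0 gt_eqF//=.
by rewrite subr_eq0 => /eqP ?; exists x.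
Qed.

(** * Averaged maps as reflected resolvents *)

Lemma averaged_cocoercive (alpha : R) S (alpha_range : 0 < alpha < 1)
    (S_avg : averaged alpha S) x y :
  dot (S x - S y) (S x - S y)
  + (alpha^-1 - 1) * dot ((x - S x) - (y - S y)) ((x - S x) - (y - S y))
  <= dot (x - y) (x - y).
Proof.
case: S_avg => T [T_ne SE]; have [a0 a1] := andP alpha_range.
have : `|T x - T y| <= 1 * `|x - y| by rewrite mul1r T_ne.
move/norm_ler_dot; rewrite expr1n mul1r.
have -> : S x - S y = (1 - alpha) *: (x - y) + alpha *: (T x - T y).
  by apply: dot_inj => w; rewrite !SE !dot_linear; ring.
have -> : (x - S x) - (y - S y) = alpha *: ((x - y) - (T x - T y)).
  by apply: dot_inj => w; rewrite !SE !dot_linear; ring.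
move: (x - y) (T x - T y) => d e ed.
rewrite !dot_linear (dotC e d).
(* The cross terms cancel because [(alpha^-1 - 1) * alpha ^+ 2 = alpha * (1 - alpha)]. *)
rewrite [leLHS](_ : _ = (1 - alpha) * dot d d + alpha * dot e e).
  by nra.
by field; rewrite gt_eqF.
Qed.

(* The operator [A] is [((Id + S) / 2)^-1 - Id]. *)
Lemma averaged_reflected_resolvent (alpha : R) S
    (alpha_range : 0 < alpha < 1) (S_avg : averaged alpha S) :
  exists A, [/\ forall x, S (x + A x) = x - A x,
    forall z, A (2^-1 *: (z + S z)) = 2^-1 *: (z - S z) &
    forall x y, (alpha^-1 - 1) * dot (A x - A y) (A x - A y)
                <= dot (A x - A y) (x - y)].
Proof.
have [a0 a1] := andP alpha_range.
have coco := averaged_cocoercive alpha_range S_avg.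
have beta0 : 0 < alpha^-1 - 1 by rewrite subr_gt0 invf_gt1.
pose J z := 2^-1 *: (z + S z).
(* Here [J] is [1 - alpha / 2] times the identity plus [alpha / 2] times the nonexpansive [T], hence
   the modulus [1 - alpha]. *)
have J_surj x : exists z, J z = x.
  apply: (@strongly_monotone_surjective J (1 - alpha) 1); first by lra.
  - exact: ler01.
  - move=> u v; have [T [T_ne SE]] := S_avg.
    have : `|T u - T v| <= 1 * `|u - v| by rewrite mul1r T_ne.
    move/norm_ler_dot; rewrite expr1n mul1r.
    have -> : J u - J v
        = (1 - alpha / 2) *: (u - v) + (alpha / 2) *: (T u - T v).
      by apply: dot_inj => w; rewrite /J !SE !dot_linear; field.
    move: (u - v) (T u - T v) => d e ed.
    by have := dot_ge0 (e + d); rewrite !dot_linear (dotC d e); nra.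
  - move=> u v; apply: dot_ler_norm => //; rewrite expr1n mul1r.
    have := coco u v; have := dot_ge0 ((u - v) - (S u - S v)).
    have := dot_ge0 ((u - S u) - (v - S v)).
    have -> : J u - J v = 2^-1 *: ((u - v) + (S u - S v)).
      by apply: dot_inj => w; rewrite /J !dot_linear; field.
    move: (u - v) (S u - S v) ((u - S u) - (v - S v)) => d e f.
    by rewrite !dot_linear (dotC e d); nra.
have [g gK] := choice J_surj.
have SA x : S (x + (g x - x)) = x - (g x - x).
  rewrite [x + _]addrC subrK; apply: dot_inj => w.
  by have := congr1 (dot^~ w) (gK x); rewrite /J !dot_linear; lra.
exists (fun x => g x - x); split => // [z|x y].
  (* Injectivity of [J]: if two points with the same image differ by [d], then their images under
     [S] differ by [- d], and [coco] leaves [4 * (alpha^-1 - 1) * dot d d <= 0]. *)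
  have := coco (g (J z)) z.
  have gE : g (J z) + S (g (J z)) = z + S z.
    by apply: (scalerI (a := 2^-1)); [rewrite invr_eq0 pnatr_eq0|exact: gK].
  have -> : S (g (J z)) - S z = - (g (J z) - z).
    apply: dot_inj => w; have := congr1 (dot^~ w) gE; rewrite !dot_linear; lra.
  have -> : g (J z) - S (g (J z)) - (z - S z) = 2 *: (g (J z) - z).
    apply: dot_inj => w; have := congr1 (dot^~ w) gE; rewrite !dot_linear; lra.
  move=> le0; have gz : g (J z) = z.
    apply/eqP; rewrite -subr_eq0 -normr_eq0 -sqrf_eq0 -dotE.
    move: le0 (dot_ge0 (g (J z) - z)); move: (g (J z) - z) => d.
    rewrite !dot_linear => le0 d0; rewrite eq_le d0 andbT.
    by rewrite -(pmulr_rle0 _ beta0); lra.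
  by rewrite gz; apply: dot_inj => w; rewrite /J !dot_linear; field.
(* With [d = x - y] and [e = A x - A y], the squared norms of [d + e] and [d - e] differ by
   [4 * dot d e], against [4 * (alpha^-1 - 1) * dot e e]. *)
have := coco (x + (g x - x)) (y + (g y - y)); rewrite !SA.
move: (g x - x) (g y - y) => u v.
have -> : x + u - (y + v) = (x - y) + (u - v).
  by apply: dot_inj => w; rewrite !dot_linear; ring.
have -> : x - u - (y - v) = (x - y) - (u - v).
  by apply: dot_inj => w; rewrite !dot_linear; ring.
have -> : x + u - (x - u) - (y + v - (y - v)) = 2 *: (u - v).
  by apply: dot_inj => w; rewrite !dot_linear; ring.
move: (x - y) (u - v) => d e.
by rewrite !dot_linear (dotC e d); lra.
Qed.

(** * Cocoercive operators and regularized sums *)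

Lemma cocoercive_lipschitz (beta : R) A (beta_gt0 : 0 < beta)
    (A_coco : forall x y,
       beta * dot (A x - A y) (A x - A y) <= dot (A x - A y) (x - y)) x y :
  `|A x - A y| <= beta^-1 * `|x - y|.
Proof.
apply: dot_ler_norm; first by rewrite invr_ge0 ltW.
have := A_coco x y; move: (A x - A y) (x - y) => d e de.
(* This square replaces the Cauchy-Schwarz inequality. *)
have := dot_ge0 (d - beta^-1 *: e); rewrite !dot_linear (dotC e d).
have : beta^-1 * (beta * dot d d) <= beta^-1 * dot d e.
  by apply: ler_wpM2l => //; rewrite invr_ge0 ltW.
by rewrite mulKf ?gt_eqF//; lra.
Qed.

(* Cocoercivity bounds [dot (C c - C x) (x - a)] uniformly in [x], as in the
   Brezis-Haraux theorem on the range of a sum of monotone operators. *)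
Lemma regularized_sum_bound (beta eps b : R) A C a c x
    (beta_gt0 : 0 < beta) (eps_ge0 : 0 <= eps) (eps_le1 : eps <= 1)
    (A_mono : forall x y, 0 <= dot (A x - A y) (x - y))
    (C_coco : forall x y,
       beta * dot (C x - C y) (C x - C y) <= dot (C x - C y) (x - y))
    (a_le : `|a| <= b) (c_le : `|c| <= b)
    (xE : eps *: x + A x + C x = A a + C c) :
  eps * `|x| ^+ 2 <= b ^+ 2 + 2 * (b ^+ 2 / beta).
Proof.
have sq_le u : `|u| <= b -> dot u u <= b ^+ 2.
  by move=> ub; rewrite dotE ler_pXn2r// nnegrE//; exact: le_trans ub.
have {sq_le} [aa cc] := (sq_le _ a_le, sq_le _ c_le).
rewrite -dotE; move: (A_mono x a) (C_coco x c).
have -> : A x - A a = - (eps *: x + (C x - C c)).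
  apply: dot_inj => w; have := congr1 (dot^~ w) xE; rewrite !dot_linear; lra.
move: (C x - C c) => e mono coco.
(* Young's inequality: the cocoercivity term [beta * dot e e] absorbs [dot e (c - a)], at the cost
   of [dot (c - a) (c - a) / (4 * beta)]. *)
have := dot_ge0 (e + (2 * beta)^-1 *: (c - a)).
rewrite -(pmulr_rge0 _ beta_gt0) => young.
have eps_xa : 0 <= eps * dot (x - a) (x - a) by rewrite mulr_ge0// dot_ge0.
(* By the parallelogram law, this gives [dot (c - a) (c - a) <= 4 * b ^+ 2]. *)
have ca := dot_ge0 (c + a).
have eps_aa : eps * dot a a <= b ^+ 2.
  by apply: le_trans aa; rewrite ler_piMl// dot_ge0.
have beta'0 : 0 < beta^-1 by rewrite invr_gt0.
have ca4 : beta^-1 * dot (c - a) (c - a) <= beta^-1 * (4 * b ^+ 2).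
  apply: ler_wpM2l; first exact: ltW.
  by move: ca; rewrite !dot_linear (dotC c a); lra.
have youngE :
    beta * dot (e + (2 * beta)^-1 *: (c - a)) (e + (2 * beta)^-1 *: (c - a))
  = beta * dot e e + dot e (c - a) + beta^-1 * dot (c - a) (c - a) / 4.
  rewrite !dot_linear (dotC c e) (dotC a e).
  by field; rewrite gt_eqF.
rewrite youngE in young; move: young ca4.
move: mono coco eps_xa; rewrite !dot_linear.
by rewrite (dotC a x); lra.
Qed.

End InnerProduct.

(** Only the summand [b / (2 * beta)] of the bracket is kept. This brings the bound of
    [regularized_sum_bound] below the square of [B]. *)
Lemma Theta_lower_bound (R : realType) (beta b e : R) (beta_gt0 : 0 < beta)
    (b_ge0 : 0 <= b) (e_ge0 : 0 <= e) : b ^+ 2 / beta <= Theta beta b b e.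
Proof.
rewrite /Theta; set s := Num.sqrt _.
have s0 : 0 <= s by exact: sqrtr_ge0.
have -> : b ^+ 2 / beta = (b + b) * (b / (2 * beta)).
  by field; rewrite gt_eqF.
apply: ler_wpM2l; first by rewrite addr_ge0.
rewrite -[leLHS]add0r lerD// ler_pM2r ?invr_gt0 ?mulr_gt0//.
have : 0 <= beta * e by rewrite mulr_ge0// ltW.
by lra.
Qed.

(* X is a real Hilbert space: a complete normed space whose norm is induced by
   the inner product dot. *)
Theorem theorem2p2 (R : realType) (X : completeNormedModType R)
    (dot : {dot X for idfun}) (dotE : forall x : X, dot x x = `|x| ^+ 2)
    (alpha1 alpha2 : R)
    (alpha1_range : 0 < alpha1 < 1) (alpha2_range : 0 < alpha2 < 1)
    (R1 R2 : X -> X)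
    (R1_averaged : averaged alpha1 R1) (R2_averaged : averaged alpha2 R2)
    (K : R -> R) (K_pos : forall eps : R, 0 < eps -> 0 < K eps)
    (K_R1 : forall eps : R, 0 < eps ->
       exists p : X, `|p| <= K eps /\ `|p - R1 p| <= eps)
    (K_R2 : forall eps : R, 0 < eps ->
       exists p : X, `|p| <= K eps /\ `|p - R2 p| <= eps) :
  forall delta : R, 0 < delta ->
    exists p : X, `|p| <= Phi alpha1 alpha2 K delta /\
      `|p - (R2 \o R1) p| <= delta.
Proof.
move=> delta delta_gt0.
have [[a10 a11] [a20 a21]] := (andP alpha1_range, andP alpha2_range).
have [A [SA AJ A_coco]] :=
  averaged_reflected_resolvent dotE alpha1_range R1_averaged.
have [C [SC CJ C_coco]] :=
  averaged_reflected_resolvent dotE alpha2_range R2_averaged.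
have beta10 : 0 < alpha1^-1 - 1 by rewrite subr_gt0 invf_gt1.
have beta20 : 0 < alpha2^-1 - 1 by rewrite subr_gt0 invf_gt1.
have A_lip := cocoercive_lipschitz dotE beta10 A_coco.
have C_lip := cocoercive_lipschitz dotE beta20 C_coco.
set b := K (delta / 4) + delta / 8.
have d40 : 0 < delta / 4 by rewrite divr_gt0.
have b0 : 0 < b by rewrite addr_gt0 ?K_pos ?divr_gt0.
(* The midpoint of [p] and [S p] is the approximate zero; it lies within [delta / 8] of [p], whence
   [b]. *)
have approx S F : (forall z, F (2^-1 *: (z + S z)) = 2^-1 *: (z - S z)) ->
    (exists p : X, `|p| <= K (delta / 4) /\ `|p - S p| <= delta / 4) ->
    exists a : X, `|a| <= b /\ `|F a| <= delta / 8.
  move=> FJ [p [p_le pS_le]]; exists (2^-1 *: (p + S p)); rewrite FJ.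
  have half_le : `|2^-1 *: (p - S p)| <= delta / 8.
    by rewrite normrZ gtr0_norm ?invr_gt0//; lra.
  split=> //; have -> : 2^-1 *: (p + S p) = p - 2^-1 *: (p - S p).
    by apply: (dot_inj dotE) => w; rewrite !(dot_linear dot); field.
  by rewrite (le_trans (ler_normB _ _))// lerD.
have [a [a_le Aa_le]] := approx _ _ AJ (K_R1 _ d40).
have [c [c_le Cc_le]] := approx _ _ CJ (K_R2 _ d40).
set B0 := B alpha2 K delta.
have Theta_ge := Theta_lower_bound (e := delta / 8) beta20 (ltW b0)
  (ltW (divr_gt0 delta_gt0 (ltr0n _ 8))).
have b2beta : 0 < b ^+ 2 / (alpha2^-1 - 1) by rewrite divr_gt0// exprn_gt0.
have b20 : 0 < b ^+ 2 by rewrite exprn_gt0.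
have B2 : b ^+ 2 + 2 * (b ^+ 2 / (alpha2^-1 - 1)) <= B0 ^+ 2.
  by rewrite /B0 /B -/b sqr_sqrtr; lra.
have B0_gt0 : 0 < B0 by rewrite /B0 /B -/b sqrtr_gt0; lra.
set M := Num.max (Num.sqrt 2) (4 * B0 / delta).
have M_gt0 : 0 < M by rewrite lt_max sqrtr_gt0 ltr0n.
have M2 : 1 <= M ^+ 2.
  have sqrt2_le : Num.sqrt 2 <= M by rewrite le_max lexx.
  have : Num.sqrt 2 ^+ 2 <= M ^+ 2.
    by rewrite ler_pXn2r// nnegrE ?sqrtr_ge0// ltW.
  by rewrite (@sqr_sqrtr R 2)//; lra.
(* The bound on [eps * |x| ^+ 2] yields [|x| <= B0 * M] and [eps * |x| <= B0 / M <= delta / 4]; the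
   entry [Num.sqrt 2] of [M] ensures [eps <= 1]. *)
pose eps := (M ^+ 2)^-1.
have eps_gt0 : 0 < eps by rewrite invr_gt0; lra.
have eps_le1 : eps <= 1 by rewrite invf_le1//; lra.
have mono (F : X -> X) (beta : R) : 0 < beta -> (forall x y,
     beta * dot (F x - F y) (F x - F y) <= dot (F x - F y) (x - y)) ->
    forall x y, 0 <= dot (F x - F y) (x - y).
  move=> beta0 F_coco x y; apply: le_trans (F_coco x y).
  by rewrite mulr_ge0 ?(dot_ge0 dotE)// ltW.
have A_mono := mono _ _ beta10 A_coco.
have C_mono := mono _ _ beta20 C_coco.
have [x xE] : exists x, eps *: x + A x + C x = A a + C c.
  apply: (@strongly_monotone_surjective _ _ _ dotE _ eps
    (eps + (alpha1^-1 - 1)^-1 + (alpha2^-1 - 1)^-1)) => //.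
  - apply: addr_ge0; last by rewrite invr_ge0 ltW.
    by apply: addr_ge0; [exact: ltW|rewrite invr_ge0 ltW].
  - move=> x y; have -> : eps *: x + A x + C x - (eps *: y + A y + C y)
        = eps *: (x - y) + (A x - A y) + (C x - C y).
      by apply: (dot_inj dotE) => w; rewrite !(dot_linear dot); ring.
    move: (A_mono x y) (C_mono x y).
    move: (x - y) (A x - A y) (C x - C y) => d u v.
    by rewrite !(dot_linear dot); lra.
  - move=> x y; have -> : eps *: x + A x + C x - (eps *: y + A y + C y)
        = eps *: (x - y) + (A x - A y) + (C x - C y).
      by apply: (dot_inj dotE) => w; rewrite !(dot_linear dot); ring.
    rewrite !mulrDl; apply: le_trans (ler_normD _ _) (lerD _ (C_lip x y)).
    apply: le_trans (ler_normD _ _) (lerD _ (A_lip x y)).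
    by rewrite normrZ gtr0_norm.
have x_sq : eps * `|x| ^+ 2 <= B0 ^+ 2.
  apply: le_trans B2; apply: (regularized_sum_bound dotE beta20) xE => //.
  exact: ltW.
have x_le : `|x| <= B0 * M.
  have BM_ge0 : 0 <= B0 * M by rewrite ltW// mulr_gt0.
  rewrite -(@ler_pXn2r _ 2) ?nnegrE// exprMn -ler_pdivrMr ?exprn_gt0//.
  by rewrite mulrC.
have eps_x_le : eps * `|x| <= delta / 4.
  have MB : 4 * B0 <= M * delta by rewrite -ler_pdivrMr// le_max lexx orbT.
  have : eps * `|x| <= eps * (B0 * M) by rewrite ler_pM2l.
  move/le_trans; apply; rewrite /eps mulrC ler_pdivrMr ?exprn_gt0//.
  have : M * (4 * B0) <= M * (M * delta) by rewrite ler_pM2l.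
  by rewrite expr2; lra.
have AC_le : `|A x + C x| <= delta / 2.
  have -> : A x + C x = A a + C c - eps *: x.
    by rewrite -xE; apply: (dot_inj dotE) => w; rewrite !(dot_linear dot); ring.
  apply: le_trans (ler_normB _ _) _; rewrite normrZ gtr0_norm//.
  by have := ler_normD (A a) (C c); lra.
exists (x + A x); split.
  (* The Lipschitz constant of [A] is [alpha1 / (1 - alpha1)]; adding [|x|] itself gives the factor
     [1 / (1 - alpha1)] in [Phi]. *)
  have Ax_le : `|A x| <= (alpha1^-1 - 1)^-1 * (`|x| + b) + delta / 8.
    have -> : A x = (A x - A a) + A a by rewrite subrK.
    apply: le_trans (ler_normD _ _) (lerD _ Aa_le).
    apply: le_trans (A_lip x a) _; rewrite ler_pM2l ?invr_gt0//.
    by apply: le_trans (ler_normB _ _) _; rewrite lerD2l.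
  have inv_beta1 : (alpha1^-1 - 1)^-1 = alpha1 / (1 - alpha1).
    by field; rewrite !gt_eqF//; lra.
  rewrite inv_beta1 in Ax_le.
  have : `|x| * (1 / (1 - alpha1)) <= B0 * M * (1 / (1 - alpha1)).
    by apply: ler_wpM2r => //; rewrite div1r invr_ge0; lra.
  have -> : `|x| * (1 / (1 - alpha1)) = `|x| + alpha1 / (1 - alpha1) * `|x|.
    by field; rewrite gt_eqF//; lra.
  rewrite /Phi -/b -/B0 -/M.
  by have := ler_normD x (A x); lra.
rewrite /= SA.
have R2_ne u v : `|R2 u - R2 v| <= 1 * `|u - v|.
  apply: (dot_ler_norm dotE) => //; rewrite expr1n mul1r.
  apply: le_trans (averaged_cocoercive dotE alpha2_range R2_averaged u v).
  by rewrite lerDl mulr_ge0 ?(dot_ge0 dotE)// ltW.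
(* Inserting [R2 (x + C x) = x - C x] leaves two terms, each of norm at most [delta / 2]. *)
have -> : x + A x - R2 (x - A x)
    = (A x + C x) + (R2 (x + C x) - R2 (x - A x)).
  by rewrite SC; apply: (dot_inj dotE) => w; rewrite !(dot_linear dot); ring.
have := R2_ne (x + C x) (x - A x).
have -> : x + C x - (x - A x) = A x + C x.
  by apply: (dot_inj dotE) => w; rewrite !(dot_linear dot); ring.
by have := ler_normD (A x + C x) (R2 (x + C x) - R2 (x - A x)); lra.
Qed.
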